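(* Let $\boldsymbol{a}=(a_1,\dots,a_N)$ be a sequence of positive integers with $\gcd(\boldsymbol{a})=1$, let $f>1$ be an integer dividing at least one $a_i$, and let $n=n(f\mid\boldsymbol{a})$, $\mathcal{P}_f$, $\Phi_f$, $\widehat{\Phi}_f$, $\mathcal{W}_f(t;\boldsymbol{a},\zeta)$, $M_m(x)$ and the Sylvester wave $W_f(t;\boldsymbol{a})$ be as defined in the context. For each $0\le m\le n-1$, write $$M_m(x)\,\widehat{\Phi}_f(x)\,\Phi_f'(x)\equiv\sum_{i=0}^{f-1}c_{m,i}\,x^i \pmod{\langle x^f-1\rangle}.$$ Then for every nonnegative integer $t$ and every $0\le m\le n-1$, $$[s^{\,n-1-m}]\sum_{\zeta\in\mathcal{P}_f}\mathcal{W}_f(t;\boldsymbol{a},\zeta)=c_{m,\hat t-1},$$ where $\hat t\in\{1,\dots,f\}$ is determined by $\hat t\equiv t\pmod f$. Furthermore, $W_f(t;\boldsymbol{a})=[P_1(t),\dots,P_f(t)]$, where for $1\le i\le f$ $$P_i(t)=\sum_{m=0}^{n-1}\frac{(-1)^{n+m+1}}{m!\,\prod_{k:\,f\mid a_k}a_k}\,c_{m,i-1}\,t^m .$$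
   Context: $\mathcal{P}_f$ is the set of primitive $f$-th roots of unity in $\mathbb{C}$; $\Phi_f(x)=\prod_{\zeta\in\mathcal{P}_f}(x-\zeta)$ is the $f$-th cyclotomic polynomial; $\widehat{\Phi}_f(x)=\frac{x^f-1}{\Phi_f(x)}$. The number $n(f\mid\boldsymbol{a})=\#\{i: f\mid a_i\}$. $[s^k]G(s)$ denotes the coefficient of $s^k$ in the power series $G(s)$. The Sylvester wave is $$W_f(t;\boldsymbol{a})=-\operatorname{Res}_{s=0}\sum_{\zeta\in\mathcal{P}_f}\frac{\zeta^{-t}e^{-ts}}{\prod_{i=1}^N(1-\zeta^{a_i}e^{a_is})},$$ where $\operatorname{Res}_{s=0}$ is the coefficient of $s^{-1}$ in the Laurent expansion at $s=0$. The notation $F(t)=[P_1(t),\dots,P_f(t)]$, with $P_i$ polynomials in $t$, means $F(t)=P_i(t)$ whenever $t\equiv i\pmod f$, $1\le i\le f$ (so $t\equiv0$ is treated as $t\equiv f$). For $P(x)\in\mathbb{Q}[x]$, $\langle P(x)\rangle_R$ denotes the unique polynomial of degree at most $\varphi(f)-1$ congruent to $P(x)$ modulo $\Phi_f(x)$, where $\varphi$ is Euler's totient function. Let $\theta_f(x)=\sum_{i=0}^{f-1}x^i$. For each $i$ with $f\nmid a_i$ put $$v_i(x)=\Big\langle -\tfrac1f\,x^{a_i}\,\theta_f'(x^{a_i})\Big\rangle_R$$ (here $\theta_f'(x^{a_i})$ is the derivative $\theta_f'$ evaluated at $x^{a_i}$); for $\zeta\in\mathcal{P}_f$ one has $v_i(\zeta)=\frac1{1-\zeta^{a_i}}$.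 Let $$g(s)=\frac{s}{e^s-1},\qquad g(s,y)=\frac{1}{1-y(e^s-1)},$$ regarded as power series in $s$. Define, for $\zeta\in\mathcal{P}_f$, $$\mathcal{W}_f(t;\boldsymbol{a},\zeta)=\zeta^{-t}\prod_{i:\,f\nmid a_i}v_i(\zeta)\prod_{i:\,f\mid a_i}g(a_is)\prod_{i:\,f\nmid a_i}g(a_is,\,v_i(\zeta)-1).$$ For $0\le k\le n-1$ let $\widehat{M}_k(x)\in\mathbb{Q}[x]$ be polynomials such that for all $\zeta\in\mathcal{P}_f$ $$\prod_{i:\,f\mid a_i}g(a_is)\prod_{i:\,f\nmid a_i}g(a_is,\,v_i(\zeta)-1)\equiv\sum_{k=0}^{n-1}\widehat{M}_k(\zeta)s^k\pmod{\langle s^n\rangle},$$ and for $0\le m\le n-1$ put $$M_m(x)=\Big\langle \widehat{M}_{n-1-m}(x)\prod_{i:\,f\nmid a_i}v_i(x)\Big\rangle_R .$$ *)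

(* Defs.v *)
From HB Require Import structures.
From mathcomp Require Import all_boot all_order all_algebra.
From mathcomp Require Import cyclic separable cyclotomic complex.
From mathcomp Require Import boolp classical_sets functions cardinality fsbigop.
From mathcomp Require Import reals zify.

Set Implicit Arguments.
Unset Strict Implicit.
Unset Printing Implicit Defensive.

Import Order.TTheory GRing.Theory Num.Theory.
Local Open Scope ring_scope.

(* A record rather than a bare [nat -> K], whose instances are pointwise. *)
Record fps (K : Type) := Fps { fps_coef : nat -> K }.

HB.instance Definition _ (K : Type) := [isNew for @fps_coef K].
HB.instance Definition _ (K : choiceType) := [Choice of fps K by <:].

Lemma fpsP (K : Type) (u v : fps K) : fps_coef u =1 fps_coef v -> u = v.
Proof. by case: u v => u [v] /= /funext ->. Qed.

Section FpsRing.
Variable K : fieldType.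
Implicit Types u v w : fps K.

Definition fps_zero : fps K := Fps (fun=> 0).
Definition fps_opp u : fps K := Fps (fun k => - fps_coef u k).
Definition fps_add u v : fps K := Fps (fun k => fps_coef u k + fps_coef v k).

Fact fps_addA : associative fps_add.
Proof. by move=> u v w; apply: fpsP => k; rewrite /= addrA. Qed.
Fact fps_addC : commutative fps_add.
Proof. by move=> u v; apply: fpsP => k; rewrite /= addrC. Qed.
Fact fps_add0 : left_id fps_zero fps_add.
Proof. by move=> u; apply: fpsP => k; rewrite /= add0r. Qed.
Fact fps_addN : left_inverse fps_zero fps_opp fps_add.
Proof. by move=> u; apply: fpsP => k; rewrite /= addNr. Qed.

HB.instance Definition _ :=
  GRing.isZmodule.Build (fps K) fps_addA fps_addC fps_add0 fps_addN.

Definition fpsC (c : K) : fps K := Fps (fun k => if k == 0%N then c else 0).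
Definition fps_mul u v : fps K :=
  Fps (fun k => \sum_(j < k.+1) fps_coef u j * fps_coef v (k - j)).

Let trunc n u : {poly K} := \poly_(i < n) fps_coef u i.

Let coef_mul_trunc n u v k : (k < n)%N ->
  fps_coef (fps_mul u v) k = (trunc n u * trunc n v)`_k.
Proof.
move=> kn; rewrite coefM /=; apply: eq_bigr => j _.
by rewrite !coef_poly !(leq_ltn_trans _ kn) ?leq_subr // -ltnS.
Qed.

Let coefM_agree (p p' q q' : {poly K}) k :
  (forall j, (j <= k)%N -> p`_j = p'`_j) ->
  (forall j, (j <= k)%N -> q`_j = q'`_j) -> (p * q)`_k = (p' * q')`_k.
Proof.
move=> pp qq; rewrite !coefM; apply: eq_bigr => j _.
by rewrite pp ?qq ?leq_subr // -ltnS.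
Qed.

Let coef_trunc n u k : (k < n)%N -> (trunc n u)`_k = fps_coef u k.
Proof. by move=> kn; rewrite coef_poly kn. Qed.

Fact fps_mulC : commutative fps_mul.
Proof.
by move=> u v; apply: fpsP => k; rewrite !(@coef_mul_trunc k.+1) // mulrC.
Qed.

Fact fps_mulA : associative fps_mul.
Proof.
move=> u v w; apply: fpsP => k; rewrite !(@coef_mul_trunc k.+1) //.
transitivity ((trunc k.+1 u * (trunc k.+1 v * trunc k.+1 w))`_k).
  apply: coefM_agree => // j jk.
  by rewrite coef_trunc ?ltnS // (@coef_mul_trunc k.+1).
rewrite mulrA; apply: coefM_agree => // j jk.
by rewrite coef_trunc ?ltnS // (@coef_mul_trunc k.+1).
Qed.

Fact fps_mul1 : left_id (fpsC 1) fps_mul.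
Proof.
move=> u; apply: fpsP => k /=; rewrite big_ord_recl /= mul1r subn0.
by rewrite big1 ?addr0 // => j _; rewrite mul0r.
Qed.

Fact fps_mulDl : left_distributive fps_mul fps_add.
Proof.
move=> u v w; apply: fpsP => k /=; rewrite -big_split /=.
by apply: eq_bigr => j _; rewrite mulrDl.
Qed.

Fact fps_1neq0 : fpsC 1 != 0.
Proof.
by apply/eqP => /(congr1 (fun u => fps_coef u 0)) /= /eqP; rewrite oner_eq0.
Qed.

HB.instance Definition _ := GRing.Zmodule_isComNzRing.Build (fps K)
  fps_mulA fps_mulC fps_mul1 fps_mulDl fps_1neq0.

Lemma coef_fpsD u v k : fps_coef (u + v) k = fps_coef u k + fps_coef v k.
Proof. by []. Qed.
Lemma coef_fpsN u k : fps_coef (- u) k = - fps_coef u k.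
Proof. by []. Qed.
Lemma coef_fpsM u v k :
  fps_coef (u * v) k = \sum_(j < k.+1) fps_coef u j * fps_coef v (k - j).
Proof. by []. Qed.
Lemma coef_fps1 k : fps_coef (1 : fps K) k = (k == 0%N)%:R.
Proof. by rewrite /=; case: eqP. Qed.

(* [fps_invs u n] is the sequence of the first n coefficients of 1 / u. *)
Fixpoint fps_invs u n : seq K :=
  if n is n'.+1 then
    let r := fps_invs u n' in
    rcons r ((fps_coef u 0)^-1 *
      ((n' == 0%N)%:R - \sum_(j < n') fps_coef u (n' - j) * r`_j))
  else [::].

Definition fps_unit : pred (fps K) := fun u => fps_coef u 0 != 0.
Definition fps_inv u : fps K :=
  if fps_unit u then Fps (fun k => (fps_invs u k.+1)`_k) else u.

Let size_fps_invs u n : size (fps_invs u n) = n.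
Proof. by elim: n => //= n IH; rewrite size_rcons IH. Qed.

Let nth_fps_invs u n k : (k < n)%N ->
  (fps_invs u n)`_k = (fps_invs u k.+1)`_k.
Proof.
elim: n => // n IH; rewrite ltnS leq_eqVlt => /predU1P [-> // | kn].
by rewrite -IH // [fps_invs u n.+1]/= nth_rcons size_fps_invs kn.
Qed.

Fact fps_mulVr : {in fps_unit, left_inverse 1 fps_inv *%R}.
Proof.
move=> u uU; have u0 : fps_coef u 0 != 0 by [].
rewrite /fps_inv ifT //; apply: fpsP => k.
rewrite coef_fpsM coef_fps1 big_ord_recr /= subnn.
rewrite nth_rcons size_fps_invs ltnn eqxx mulrAC mulVf // mul1r.
rewrite (eq_bigr (fun j : 'I_k => fps_coef u (k - j) * (fps_invs u k)`_j)).
  by rewrite addrC subrK.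
by move=> j _; rewrite mulrC -(nth_fps_invs _ (ltn_ord j)).
Qed.

Fact fps_unitP u v : v * u = 1 -> fps_unit u.
Proof.
move=> /(congr1 (fun w => fps_coef w 0)); rewrite coef_fpsM big_ord1 /= => uv.
by apply/eqP => u0; move/eqP: uv; rewrite u0 mulr0 eq_sym oner_eq0.
Qed.

Fact fps_inv_out : {in [predC fps_unit], fps_inv =1 id}.
Proof. by move=> u uU; rewrite /fps_inv ifN. Qed.

HB.instance Definition _ := GRing.ComNzRing_hasMulInverse.Build (fps K)
  fps_mulVr fps_unitP fps_inv_out.

Definition fpsX : fps K := Fps (fun k => (k == 1%N)%:R).

Lemma coef_fpsXnM u m k :
  fps_coef (fpsX ^+ m * u) k = if (k < m)%N then 0 else fps_coef u (k - m).
Proof.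
elim: m u k => [|m IH] u k; first by rewrite expr0 mul1r subn0.
rewrite exprSr -mulrA IH; case: ltnP => km; first by rewrite ltnS ltnW.
rewrite coef_fpsM big_ord_recl /= mul0r add0r ltnS.
case: leqP => [km'|mk].
  by rewrite (_ : (k - m = 0)%N) ?big_ord0 //; apply/eqP.
have [d ->] : exists d, k = (m + d.+1)%N.
  by exists (k - m.+1)%N; rewrite -addSnnS subnKC.
rewrite addKn big_ord_recl /= mul1r big1 ?addr0 => [|j _]; last by rewrite mul0r.
by rewrite -addSnnS addKn subn1.
Qed.

Lemma fps_valuation u : u != 0 ->
  exists m v, u = fpsX ^+ m * v /\ fps_coef v 0 != 0.
Proof.
move=> u0; have ex : exists k, fps_coef u k != 0.
  apply: contrapT => H; case/eqP: u0; apply: fpsP => k; apply/eqP.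
  by apply: contrapT => /negP uk; apply: H; exists k.
case: (ex_minnP ex) => m um min.
exists m, (Fps (fun k => fps_coef u (k + m))); split => //.
apply: fpsP => k; rewrite coef_fpsXnM /=; case: ltnP => [km | mk].
  by apply/eqP; apply: contraTT km => /min; rewrite -leqNgt.
by rewrite subnK.
Qed.

Fact fps_integral u v : u * v = 0 -> (u == 0) || (v == 0).
Proof.
move=> uv0; case: eqVneq => // /fps_valuation [m [u' [Eu u'0]]].
case: eqVneq => // /fps_valuation [l [v' [Ev v'0]]].
have: fps_coef (u * v) (m + l) = fps_coef u' 0 * fps_coef v' 0.
  rewrite Eu Ev mulrACA -exprD coef_fpsXnM ltnn subnn coef_fpsM big_ord1.
  by rewrite subnn.
by rewrite uv0 /= => /esym/eqP; rewrite mulf_eq0 (negbTE u'0) (negbTE v'0).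
Qed.

HB.instance Definition _ := GRing.ComUnitRing_isIntegral.Build (fps K)
  fps_integral.

Lemma fpsX_neq0 : fpsX != 0.
Proof.
by apply/eqP => /(congr1 (fun u => fps_coef u 1)) /= /eqP; rewrite oner_eq0.
Qed.

End FpsRing.

(* K((s)), as the fraction field of K[[s]]. *)
Notation laurent K := {fraction fps K}.

Section Laurent.
Variable K : fieldType.

Definition ofps (u : fps K) : laurent K := FracField.tofrac u.

Definition lconst (c : K) : laurent K := ofps (fpsC c).
Definition lvar : laurent K := ofps (fpsX K).

(* The Laurent expansion of x is s^(-m) * u for any m, u with x * s^m = u. *)
Definition laurent_coef (x : laurent K) (k : int) : K :=
  let: (m, u) := xget (0%N, 0)
    [set mu : nat * fps K | x * lvar ^+ mu.1 = ofps mu.2]%classic in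
  if k + m%:Z is Posz j then fps_coef u j else 0.

Definition residue (x : laurent K) : K := laurent_coef x (- 1).

(* x = y modulo the ideal s^n K[[s]] of K[[s]]. *)
Definition fps_congr (n : nat) (x y : laurent K) : Prop :=
  exists u : fps K, x - y = lvar ^+ n * ofps u.

(* exp (c s) *)
Definition lexp (c : K) : laurent K :=
  ofps (Fps (fun k => c ^+ k / k`!%:R)).

Lemma lvarX m : lvar ^+ m = ofps (fpsX K ^+ m).
Proof. by rewrite /lvar /ofps -tofracXn. Qed.

Lemma fraction_numden (R : idomainType) (x : {fraction R}) :
  exists n d : R, d != 0 /\ x * FracField.tofrac d = FracField.tofrac n.
Proof.
elim/quotW: x => -[[p q] /= q0]; exists p, q; split=> //.
rewrite /GRing.mul /= !piE; apply/eqmodP => /=.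
rewrite FracField.equivfE /FracField.mulf !numden_Ratio ?mulf_neq0 ?oner_eq0 //=.
by rewrite !mulr1 mulrC.
Qed.

Lemma laurent_expansion (x : laurent K) :
  exists m u, x * lvar ^+ m = ofps u.
Proof.
have [p [q [q0 xq]]] := fraction_numden x.
have [m [q' [Eq q'0]]] := fps_valuation q0.
have q'U : q' \is a GRing.unit by [].
exists m, (p / q').
by rewrite lvarX /ofps tofracM -xq -mulrA -tofracM Eq mulrK.
Qed.

Lemma laurent_coefE (x : laurent K) m u (k : int) :
  x * lvar ^+ m = ofps u ->
  laurent_coef x k = if k + m%:Z is Posz j then fps_coef u j else 0.
Proof.
move=> xu; rewrite /laurent_coef; case: xgetP => [[m' u'] _ /= xu' | /(_ (m, u))];
  last by rewrite /= xu.
have uu : fpsX K ^+ m' * u = fpsX K ^+ m * u'.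
  apply/eqP; rewrite -tofrac_eq !tofracM -!/(ofps _) -!lvarX -xu -xu'.
  by rewrite mulrCA [_ ^+ m * _]mulrCA [_ ^+ m' * _]mulrC.
have coefu n : (if (n < m')%N then 0 else fps_coef u (n - m')) =
               (if (n < m)%N then 0 else fps_coef u' (n - m)).
  by rewrite -!coef_fpsXnM uu.
case Da: (k + m'%:Z) => [a|a]; case Db: (k + m%:Z) => [b|b] //.
- have := coefu (m + a)%N; do 2!case: ltnP => ?; try lia.
  rewrite addKn => <-; congr (fps_coef _ _); lia.
- by have := coefu (m + a)%N; do 2!case: ltnP => ?; try lia; rewrite addKn.
- by have := coefu (m' + b)%N; do 2!case: ltnP => ?; try lia; rewrite addKn.
Qed.

Lemma laurent_coef_ofps u (k : nat) : laurent_coef (ofps u) k%:Z = fps_coef u k.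
Proof. by rewrite (@laurent_coefE _ 0%N u) ?expr0 ?mulr1 // addr0. Qed.

End Laurent.

(* The complex numbers, packed so that all their structures come from one
   instance. *)
Definition CC (R : realType) : numClosedFieldType := R[i].

Definition prim_roots (C : fieldType) (f : nat) : set C :=
  [set z | f.-primitive_root z]%classic.
Arguments prim_roots : clear implicits.

Definition PhiQ (f : nat) : {poly rat} := map_poly intr 'Phi_f.
Definition Phi_hat (f : nat) : {poly rat} := ('X^f - 1) %/ PhiQ f.

Definition rem_Phi (f : nat) (P : {poly rat}) : {poly rat} := P %% PhiQ f.

Definition poly_congr (d P Q : {poly rat}) : Prop := d %| P - Q.

Definition ratr_eval (C : fieldType) (P : {poly rat}) (x : C) : C :=
  (map_poly ratr P).[x].

Section CyclotomicC.
Variables (C : numClosedFieldType) (f : nat).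
Hypothesis f_gt0 : (0 < f)%N.

Lemma prim_roots_exists : exists z : C, f.-primitive_root z.
Proof.
pose p : {poly C} := 'X^f - 1; have [r Dp] := closed_field_poly_normal p.
rewrite (monicP _) ?monicXnsubC // scale1r in Dp.
have rn1: all f.-unity_root r by apply/allP=> z; rewrite -root_prod_XsubC -Dp.
have sz_r: (f < (size r).+1)%N.
  by rewrite -(size_prod_XsubC r id) -Dp size_XnsubC.
have [|z] := hasP (has_prim_root f_gt0 rn1 _ sz_r); last by exists z.
by rewrite -separable_prod_XsubC -Dp separable_Xn_sub_1 // pnatr_eq0 -lt0n.
Qed.

End CyclotomicC.

Lemma map_Cyclotomic (C : numFieldType) n (z : C) :
  n.-primitive_root z -> map_poly intr 'Phi_n = cyclotomic z n.
Proof.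
elim/ltn_ind: n z => n IHn z prim_z.
have n_gt0 := prim_order_gt0 prim_z.
have nD : n \in divisors n by rewrite -dvdn_divisors.
pose q : {poly C} := \prod_(d <- rem n (divisors n)) map_poly intr 'Phi_d.
have q0 : q != 0.
  apply: monic_neq0; apply: monic_prod => d _.
  by apply: monic_map; exact: Cyclotomic_monic.
apply: (mulIf q0).
have E : map_poly intr ('X^n - 1 : {poly int}) = 'X^n - 1 :> {poly C}.
  by rewrite rmorphB /= rmorph1 map_polyXn.
transitivity ('X^n - 1 : {poly C}).
  by rewrite -E -prod_Cyclotomic // (big_rem n) //= rmorphM rmorph_prod.
rewrite (prod_cyclotomic prim_z) (big_rem n) //= divnn n_gt0 expr1.
congr (_ * _); apply: eq_big_seq => d.
rewrite mem_rem_uniq ?divisors_uniq // !inE -dvdn_divisors // => /andP[dn dvd].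
by rewrite -IHn ?dvdn_prim_root // ltn_neqAle dn dvdn_leq.
Qed.

(* Agreement of mathcomp's ['Phi_f], defined through [algC], with the product
   over the primitive roots in C. *)
Lemma PhiQ_prod (C : numClosedFieldType) f : (0 < f)%N ->
  map_poly ratr (PhiQ f) =
    \big[*%R/1]_(z \in prim_roots C f) ('X - z%:P) :> {poly C}.
Proof.
move=> f_gt0; have [z pz] := @prim_roots_exists C f f_gt0.
rewrite /PhiQ -map_poly_comp (eq_map_poly (g := intr)); last first.
  by move=> n /=; rewrite ratr_int.
rewrite (map_Cyclotomic pz) /cyclotomic.
pose r := [seq z ^+ (k : 'I_f) | k <- enum [pred k : 'I_f | coprime k f]].
have rE x : (x \in r) = f.-primitive_root x.
  rewrite -(root_cyclotomic pz) /cyclotomic -root_prod_XsubC /r.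
  by rewrite big_map big_enum.
have ru : uniq r.
  rewrite map_inj_in_uniq ?enum_uniq // => i j _ _ /eqP.
  by rewrite (eq_prim_root_expr pz) !modn_small // => /eqP/val_inj.
have -> : prim_roots C f = [set` r]%classic.
  by apply/seteqP; split => x /=; rewrite rE.
by rewrite -fsbig_seq // /r big_map big_enum.
Qed.

Section SylvesterWave.
Variables (C : numClosedFieldType) (N : nat) (a : 'I_N -> nat) (f : nat).

Definition ndvd : nat := #|[set i : 'I_N | (f %| a i)%N]|.

Definition sylvester_wave (t : int) : C :=
  - residue (\sum_(z \in prim_roots C f)
      (lconst (z ^ (- t)) * lexp (- t%:~R)
         / \prod_(i < N) (1 - lconst (z ^+ a i) * lexp (a i)%:R))).

Definition theta : {poly rat} := \sum_(i < f) 'X^i.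

Definition vpoly (i : 'I_N) : {poly rat} :=
  rem_Phi f (- f%:R^-1 *: ('X^(a i) * (theta^`() \Po 'X^(a i)))).

(* g(c s) and g(c s, y); for c != 0 both lie in K[[s]]. *)
Definition gser (c : C) : laurent C := lconst c * lvar C / (lexp c - 1).
Definition gser2 (c y : C) : laurent C := (1 - lconst y * (lexp c - 1))^-1.

Definition gprod (z : C) : laurent C :=
  \prod_(i < N | (f %| a i)%N) gser (a i)%:R *
  \prod_(i < N | ~~ (f %| a i)%N) gser2 (a i)%:R (ratr_eval (vpoly i) z - 1).

Definition wave_ser (t : int) (z : C) : laurent C :=
  lconst (z ^ (- t)) *
  (\prod_(i < N | ~~ (f %| a i)%N) lconst (ratr_eval (vpoly i) z)) * gprod z.

Definition Mpoly (Mhat : nat -> {poly rat}) (m : nat) : {poly rat} :=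
  rem_Phi f (Mhat (ndvd - 1 - m)%N * \prod_(i < N | ~~ (f %| a i)%N) vpoly i).

End SylvesterWave.

(* F = [P_1, ..., P_f] *)
Definition quasi_poly (C : numClosedFieldType) (f : nat) (F : int -> C)
    (P : nat -> {poly rat}) : Prop :=
  forall (t : int) (i : nat), (1 <= i <= f)%N -> (t = i %[mod f])%Z ->
    F t = ratr_eval (P i) t%:~R.

(* Main.v *)
Require Import Defs.
From mathcomp Require Import all_boot all_order all_algebra.
From mathcomp Require Import classical_sets fsbigop reals.
From mathcomp Require Import cyclotomic zify ring.

(** The constants [c m i] are discrete Fourier coefficients. By [dft_coef],
    [f * c m i] is the sum of [Q(w) * w^(-i)] over all [f]-th roots of unity
    [w], where [Q = M_m * Phi_hat * Phi']. The factor [Phi_hat] vanishes at the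
    [w] that are not primitive, and differentiating [Phi_hat * Phi = 'X^f - 1]
    gives [Phi_hat(z) * Phi'(z) = f / z] at a primitive [z]. Hence [c m i] is
    the sum of [M_m(z) * z^(-(i+1))] over the primitive [z]
    ([sum_prim_roots_PhiQ_dft]); this only depends on [i + 1] modulo [f]. As
    [M_m(z)] is the coefficient of [s^(n-1-m)] in the wave series at [z] without
    its factor [z^(-t)] ([wave_ser_ofps]), the first assertion follows.

    For the second one, write [n] for [ndvd a f]. Each factor
    [1 / (1 - z^a_i e^(a_i s))] is [- g(a_i s) / (a_i s)] when [f] divides [a_i]
    ([pole_factor]) and [v_i(z) * g(a_i s, v_i(z) - 1)] otherwise
    ([regular_factor]). So the function whose residue is taken is [s^(-n)] times
    a constant times [e^(-ts)] times the sum of the wave series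
    ([sylvester_waveE]), and its residue is read off the coefficient of
    [s^(n-1)] of a product of two power series: the coefficients of [e^(-ts)]
    yield the powers of [t], those of the other factor the [c m i]. *)

Set Implicit Arguments.
Unset Strict Implicit.
Unset Printing Implicit Defensive.

Import Order.TTheory GRing.Theory Num.Theory.
Local Open Scope ring_scope.

(** * Roots of unity *)

Section RootsOfUnity.
Variables (C : numClosedFieldType) (f : nat).

Lemma prim_root_neq0 (z : C) : f.-primitive_root z -> z != 0.
Proof. by move=> pz; rewrite (prim_root_eq0 pz) -lt0n (prim_order_gt0 pz). Qed.

Lemma prim_root_expz_mod (z : C) (t u : int) :
  f.-primitive_root z -> (t = u %[mod f])%Z -> z ^ t = z ^ u.
Proof.
move=> pz tu; have z0 : z != 0 := prim_root_neq0 pz.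
have zmod (w : int) : z ^ w = z ^ (w %% f)%Z.
  rewrite {1}(divz_eq w f) expfzDr // mulrC -exprz_exp exprzAC.
  by rewrite -exprnP prim_expr_order // exp1rz mulr1.
by rewrite zmod tu -zmod.
Qed.

Lemma sum_prim_roots (V : zmodType) (z : C) (F : C -> V) :
  f.-primitive_root z ->
  \sum_(x \in prim_roots C f) F x =
  \sum_(k < f | f.-primitive_root (z ^+ k)) F (z ^+ k).
Proof.
move=> pz.
pose A := [pred k : 'I_f | f.-primitive_root (z ^+ k)].
pose r := [seq z ^+ (k : 'I_f) | k <- enum A].
have ru : uniq r.
  rewrite map_inj_in_uniq ?enum_uniq // => i j _ _ /eqP.
  by rewrite (eq_prim_root_expr pz) !modn_small // => /eqP/val_inj.
have rE x : (x \in r) = f.-primitive_root x.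
  apply/mapP/idP => [[k]|px]; first by rewrite mem_enum inE => pk ->.
  have [k xk] := prim_rootP pz (prim_expr_order px).
  by exists k => //; rewrite mem_enum inE -xk.
have -> : prim_roots C f = [set` r]%classic.
  by apply/seteqP; split => x /=; rewrite rE.
by rewrite -fsbig_seq // /r big_map big_enum.
Qed.

Lemma sum_unity_expr (w : C) : w ^+ f = 1 -> w != 1 -> \sum_(k < f) w ^+ k = 0.
Proof.
move=> wf1 w1; apply: (mulfI (x := w - 1)); first by rewrite subr_eq0.
by rewrite -subrX1 wf1 subrr mulr0.
Qed.

End RootsOfUnity.

(** * Values of rational and cyclotomic polynomials at roots of unity *)

Section Evaluation.
Variable C : numClosedFieldType.
Implicit Types (P Q : {poly rat}) (x : C).

Lemma ratr_evalB P Q x : ratr_eval (P - Q) x = ratr_eval P x - ratr_eval Q x.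
Proof. by rewrite /ratr_eval rmorphB hornerD hornerN. Qed.

Lemma ratr_evalM P Q x : ratr_eval (P * Q) x = ratr_eval P x * ratr_eval Q x.
Proof. by rewrite /ratr_eval rmorphM hornerM. Qed.

Lemma ratr_evalZ c P x : ratr_eval (c *: P) x = ratr c * ratr_eval P x.
Proof. by rewrite /ratr_eval map_polyZ hornerZ. Qed.

Lemma ratr_evalXn n x : ratr_eval 'X^n x = x ^+ n.
Proof. by rewrite /ratr_eval map_polyXn hornerXn. Qed.

Lemma ratr_eval1 x : ratr_eval 1 x = 1.
Proof. by rewrite /ratr_eval rmorph1 hornerC. Qed.

Lemma ratr_eval_sum (I : Type) (r : seq I) (A : pred I) (F : I -> {poly rat}) x :
  ratr_eval (\sum_(i <- r | A i) F i) x = \sum_(i <- r | A i) ratr_eval (F i) x.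
Proof. by rewrite /ratr_eval rmorph_sum horner_sum. Qed.

Lemma ratr_eval_prod (I : Type) (r : seq I) (A : pred I) (F : I -> {poly rat}) x :
  ratr_eval (\prod_(i <- r | A i) F i) x = \prod_(i <- r | A i) ratr_eval (F i) x.
Proof. by rewrite /ratr_eval rmorph_prod horner_prod. Qed.

Lemma ratr_eval_comp P Q x : ratr_eval (P \Po Q) x = ratr_eval P (ratr_eval Q x).
Proof. by rewrite /ratr_eval map_comp_poly horner_comp. Qed.

Lemma ratr_eval_dvdp d P x : d %| P -> ratr_eval d x = 0 -> ratr_eval P x = 0.
Proof. by move=> /divpK <- dx0; rewrite ratr_evalM dx0 mulr0. Qed.

Variable f : nat.

Lemma ratr_eval_PhiQ (z x : C) : f.-primitive_root z ->
  (ratr_eval (PhiQ f) x == 0) = f.-primitive_root x.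
Proof.
move=> pz; rewrite -(root_cyclotomic pz) -(map_Cyclotomic pz) /root.
rewrite /ratr_eval /PhiQ -map_poly_comp (eq_map_poly (g := intr)) // => n /=.
by rewrite ratr_int.
Qed.

Lemma ratr_eval_rem_Phi P x : f.-primitive_root x ->
  ratr_eval (rem_Phi f P) x = ratr_eval P x.
Proof.
move=> px; rewrite {2}(divp_eq P (PhiQ f)) /rem_Phi /ratr_eval rmorphD hornerD.
rewrite rmorphM hornerM -/(ratr_eval (PhiQ f) x).
by move: (px); rewrite -(ratr_eval_PhiQ _ px) => /eqP ->; rewrite mulr0 add0r.
Qed.

Lemma PhiQ_hat : (0 < f)%N -> Phi_hat f * PhiQ f = 'X^f - 1.
Proof.
move=> f_gt0; apply: divpK.
have -> : 'X^f - 1 = map_poly intr ('X^f - 1) :> {poly rat}.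
  by rewrite rmorphB /= rmorph1 map_polyXn.
rewrite -prod_Cyclotomic // (big_rem f) /= -?dvdn_divisors //.
by rewrite rmorphM dvdp_mulr.
Qed.

Lemma ratr_eval_Phi_hat_eq0 (z x : C) : f.-primitive_root z ->
  x ^+ f = 1 -> ~~ f.-primitive_root x -> ratr_eval (Phi_hat f) x = 0.
Proof.
move=> pz xf1; rewrite -(ratr_eval_PhiQ _ pz) => nx; apply: (mulIf nx).
rewrite -ratr_evalM PhiQ_hat ?(prim_order_gt0 pz) //.
by rewrite ratr_evalB ratr_evalXn ratr_eval1 xf1 subrr mul0r.
Qed.

(** Differentiate [Phi_hat f * PhiQ f = 'X^f - 1] at a root of [PhiQ f]. *)
Lemma ratr_eval_Phi_hat_deriv x : f.-primitive_root x ->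
  ratr_eval (Phi_hat f * (PhiQ f)^`()) x = f%:R / x.
Proof.
move=> px; have f_gt0 := prim_order_gt0 px.
have x0 : x != 0 := prim_root_neq0 px.
have := congr1 (fun P => ratr_eval P^`() x) (PhiQ_hat f_gt0).
rewrite derivM derivB derivXn derivC subr0 -scaler_nat ratr_evalZ ratr_evalXn.
rewrite ratr_nat /ratr_eval rmorphD hornerD -!/(ratr_eval _ x).
rewrite [ratr_eval (_ * PhiQ f) x]ratr_evalM.
move: (px); rewrite -(ratr_eval_PhiQ _ px) => /eqP ->; rewrite mulr0 add0r => ->.
by apply: (mulIf x0); rewrite -mulrA -exprSr prednK // (prim_expr_order px)
  mulfVK ?mulr1.
Qed.

(** Inversion of the discrete Fourier transform on the [f]-th roots of unity. *)
Lemma dft_coef (z : C) P (c : nat -> rat) (j : 'I_f) : f.-primitive_root z ->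
  poly_congr ('X^f - 1) P (\sum_(i < f) c i *: 'X^i) ->
  \sum_(k < f) ratr_eval P (z ^+ k) / (z ^+ k) ^+ j = f%:R * ratr (c j).
Proof.
move=> pz Pc; have zf1 := prim_expr_order pz.
have z0 : z != 0 := prim_root_neq0 pz.
have PE (k : 'I_f) : ratr_eval P (z ^+ k) / (z ^+ k) ^+ j =
    \sum_(i < f) ratr (c i) * (z ^+ i / z ^+ j) ^+ k.
  have /eqP : ratr_eval (P - \sum_(i < f) c i *: 'X^i) (z ^+ k) = 0.
    apply: ratr_eval_dvdp Pc _.
    by rewrite ratr_evalB ratr_evalXn ratr_eval1 exprAC zf1 expr1n subrr.
  rewrite ratr_evalB subr_eq0 => /eqP ->; rewrite ratr_eval_sum mulr_suml.
  apply: eq_bigr => i _; rewrite ratr_evalZ ratr_evalXn -mulrA.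
  by rewrite expr_div_n -!(exprAC _ k).
rewrite (eq_bigr _ (fun k _ => PE k)) exchange_big /= (bigD1 j) //=.
rewrite [X in _ + X]big1 ?addr0 => [|i ij].
  rewrite -mulr_sumr divff ?expf_neq0 //.
  under eq_bigr do rewrite expr1n.
  by rewrite sumr_const card_ord mulrC.
rewrite -mulr_sumr sum_unity_expr ?mulr0 //.
  by rewrite expr_div_n ![(_ ^+ _) ^+ f]exprAC zf1 !expr1n divr1.
rewrite -subr_eq0 -(mulfV (expf_neq0 j z0)) -mulrBl.
rewrite mulf_neq0 ?invr_eq0 ?expf_neq0 //.
by rewrite subr_eq0 (eq_prim_root_expr pz) !modn_small.
Qed.

End Evaluation.

(** * Power series inside Laurent series *)

Section PowerSeries.
Variable K : fieldType.
Implicit Types (u : fps K) (x : laurent K) (k : nat).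

Lemma coef_fpsCM (b : K) u k : fps_coef (fpsC b * u) k = b * fps_coef u k.
Proof.
rewrite coef_fpsM big_ord_recl /= subn0 big1 ?addr0 // => j _.
by rewrite mul0r.
Qed.

Lemma coef_fps_sum (I : Type) (r : seq I) (A : pred I) (F : I -> fps K) k :
  fps_coef (\sum_(i <- r | A i) F i) k = \sum_(i <- r | A i) fps_coef (F i) k.
Proof. by elim/big_rec2: _ => // i u y _ <-. Qed.

Lemma lconstM (b d : K) : lconst (b * d) = lconst b * lconst d.
Proof.
rewrite /lconst /ofps -tofracM; congr (FracField.tofrac _); apply: fpsP => k.
by rewrite coef_fpsCM /=; case: ifP; rewrite ?mulr0.
Qed.

Lemma lconst1 : lconst (1 : K) = 1.
Proof. by rewrite /lconst /ofps -tofrac1. Qed.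

Lemma lconstB (b d : K) : lconst (b - d) = lconst b - lconst d.
Proof.
rewrite /lconst /ofps -tofracB; congr (FracField.tofrac _); apply: fpsP => k.
by rewrite coef_fpsD coef_fpsN /=; case: ifP; rewrite ?subrr.
Qed.

Lemma lconst0 : lconst (0 : K) = 0.
Proof. by rewrite -(subrr 1) lconstB subrr. Qed.

Lemma lconstN (b : K) : lconst (- b) = - lconst b.
Proof. by rewrite -sub0r lconstB lconst0 sub0r. Qed.

Lemma lconst_prod (I : Type) (r : seq I) (A : pred I) (F : I -> K) :
  lconst (\prod_(i <- r | A i) F i) = \prod_(i <- r | A i) lconst (F i).
Proof. exact: (big_morph _ lconstM lconst1). Qed.

Lemma lvar_neq0 : lvar K != 0.
Proof. by rewrite /lvar /ofps tofrac_eq0 fpsX_neq0. Qed.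

Lemma lconst_neq0 (b : K) : b != 0 -> lconst b != 0.
Proof.
move=> b0; rewrite /lconst /ofps tofrac_eq0.
by apply: contra b0 => /eqP/(congr1 (fun u => fps_coef u 0)) /= ->.
Qed.

Lemma lconstV (b : K) : lconst b^-1 = (lconst b)^-1.
Proof.
have [->|b0] := eqVneq b 0; first by rewrite invr0 lconst0 invr0.
apply: (mulfI (lconst_neq0 b0)).
by rewrite -lconstM !divff ?lconst1 ?lconst_neq0.
Qed.

(** The power series with the coefficients of nonnegative index of [x]. *)
Definition regular_part x : fps K := Fps (fun k => laurent_coef x k).

Lemma regular_part_ofps u : regular_part (ofps u) = u.
Proof. by apply: fpsP => k; rewrite /= laurent_coef_ofps. Qed.

(** A Laurent series congruent modulo [s^n K[[s]]] to a polynomial is a power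
    series, and its first [n] coefficients are those of the polynomial. *)
Lemma fps_congr_trunc n x (b : nat -> K) :
  fps_congr n x (\sum_(k < n) lconst (b k) * lvar K ^+ k) ->
  exists u, x = ofps u /\ forall k, (k < n)%N -> fps_coef u k = b k.
Proof.
case=> w /eqP; rewrite subr_eq => /eqP xE.
exists (fpsX K ^+ n * w + \sum_(k < n) fpsX K ^+ k * fpsC (b k)); split.
  rewrite xE /ofps tofracD tofracM rmorph_sum lvarX; congr (_ + _).
  by apply: eq_bigr => k _; rewrite lvarX mulrC [RHS]tofracM.
move=> k kn; rewrite coef_fpsD coef_fpsXnM kn add0r coef_fps_sum.
rewrite (bigD1 (Ordinal kn)) // coef_fpsXnM ltnn subnn.
rewrite [X in _ + X = _]big1 => [|j jk]; first exact: addr0.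
rewrite coef_fpsXnM /=; case: ltnP => // le_jk.
by rewrite ifN // subn_eq0 -ltnNge ltn_neqAle le_jk andbT; exact: jk.
Qed.

End PowerSeries.

(** * The wave series and the residue *)

(** With [v = 1 / (1 - x)], this reads
    [1 / (1 - x e) = v / (1 - (v - 1) (e - 1))]. *)
Lemma inv_one_subM (F : fieldType) (x e : F) : 1 - x != 0 ->
  (1 - x * e)^-1 = (1 - x)^-1 * (1 - ((1 - x)^-1 - 1) * (e - 1))^-1.
Proof. by move=> x10; rewrite -invfM; congr (_^-1); field. Qed.

Section Wave.
Variables (C : numClosedFieldType) (N : nat) (a : 'I_N -> nat) (f : nat).
Implicit Types (z : C) (t : int).

Lemma theta_root (x : C) : x ^+ f = 1 -> x != 1 -> ratr_eval (theta f) x = 0.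
Proof.
move=> xf1 x1; rewrite /theta ratr_eval_sum.
by under eq_bigr do rewrite ratr_evalXn; exact: sum_unity_expr.
Qed.

(** Differentiate [('X - 1) * theta f = 'X^f - 1] at a root of [theta f]. *)
Lemma theta_deriv (x : C) : (0 < f)%N -> x ^+ f = 1 -> x != 1 ->
  ratr_eval (theta f)^`() x * x = f%:R / (x - 1).
Proof.
move=> f_gt0 xf1 x1; have x10 : x - 1 != 0 by rewrite subr_eq0.
have E : 'X^f - 1 = ('X - 1) * theta f := subrX1 _ _.
have := congr1 (fun P => ratr_eval P^`() x) E.
rewrite derivM !derivB derivXn derivX derivC !subr0 mul1r.
rewrite -scaler_nat ratr_evalZ ratr_evalXn ratr_nat.
rewrite [in RHS]/ratr_eval rmorphD hornerD -!/(ratr_eval _ x) theta_root // add0r.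
rewrite ratr_evalM ratr_evalB ratr_eval1 -['X]expr1 ratr_evalXn expr1.
move=> H; apply: (mulfI x10); rewrite mulrA -H -mulrA -exprSr prednK //.
by rewrite xf1 mulr1 mulrCA divff ?mulr1.
Qed.

Lemma prim_root_expr_neq1 z i :
  f.-primitive_root z -> ~~ (f %| a i)%N -> z ^+ a i != 1.
Proof. by move=> pz; rewrite (prim_order_dvd pz). Qed.

(** The interpretation of [v_i]: at a primitive root it inverts [1 - z ^+ a i]. *)
Lemma vpoly_eval z i : f.-primitive_root z -> ~~ (f %| a i)%N ->
  ratr_eval (vpoly a f i) z = (1 - z ^+ a i)^-1.
Proof.
move=> pz ndvd_i; have f_gt0 := prim_order_gt0 pz.
have x1 := prim_root_expr_neq1 pz ndvd_i.
have xf1 : (z ^+ a i) ^+ f = 1 by rewrite exprAC (prim_expr_order pz) expr1n.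
rewrite /vpoly ratr_eval_rem_Phi // ratr_evalZ ratr_evalM ratr_eval_comp.
rewrite !ratr_evalXn [_ * ratr_eval _ _]mulrC theta_deriv //.
rewrite rmorphN fmorphV rmorph_nat mulNr mulKf; first by rewrite -invrN opprB.
by rewrite pnatr_eq0 -lt0n.
Qed.

(** Factors of the wave with [f] dividing [a i] contribute a simple pole. *)
Lemma pole_factor z i : (0 < a i)%N -> f.-primitive_root z -> (f %| a i)%N ->
  (1 - lconst (z ^+ a i) * lexp (a i)%:R)^-1 =
  - (lconst (a i)%:R * lvar C)^-1 * gser (a i)%:R.
Proof.
move=> ai pz dvd_i; rewrite /gser (eqP (_ : z ^+ a i == 1)); last first.
  by rewrite -(prim_order_dvd pz).
rewrite lconst1 mul1r -opprB invrN mulNr mulKf //.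
by rewrite mulf_neq0 ?lvar_neq0 // lconst_neq0 // pnatr_eq0 -lt0n.
Qed.

(** Factors of the wave with [f] not dividing [a i] are regular at [s = 0]. *)
Lemma regular_factor z i : f.-primitive_root z -> ~~ (f %| a i)%N ->
  (1 - lconst (z ^+ a i) * lexp (a i)%:R)^-1 =
  lconst (ratr_eval (vpoly a f i) z) *
    gser2 (a i)%:R (ratr_eval (vpoly a f i) z - 1).
Proof.
move=> pz ndvd_i; have x1 := prim_root_expr_neq1 pz ndvd_i.
rewrite vpoly_eval // /gser2 lconstV !lconstB lconstV lconstB lconst1.
apply: inv_one_subM; rewrite -lconst1 -lconstB lconst_neq0 //.
by rewrite subr_eq0 eq_sym.
Qed.

(** The given truncation of [gprod] makes the wave series a power series, whose
    first coefficients are the values of the [Mpoly] up to [z ^ (- t)]. *)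
Lemma wave_ser_ofps (Mhat : nat -> {poly rat}) t z : f.-primitive_root z ->
  fps_congr (ndvd a f) (gprod a f z)
    (\sum_(k < ndvd a f) lconst (ratr_eval (Mhat k) z) * lvar C ^+ k) ->
  exists u, wave_ser a f t z = ofps u /\
    forall m, (m < ndvd a f)%N ->
      fps_coef u (ndvd a f - 1 - m) = z ^ (- t) * ratr_eval (Mpoly a f Mhat m) z.
Proof.
move=> pz /(@fps_congr_trunc _ _ _ (fun k => ratr_eval (Mhat k) z)) [u [guE uE]].
pose b := z ^ (- t) * \prod_(i < N | ~~ (f %| a i)%N) ratr_eval (vpoly a f i) z.
exists (fpsC b * u); split.
  by rewrite /wave_ser -lconst_prod -lconstM -/b guE /lconst /ofps -tofracM.
move=> m mn; rewrite coef_fpsCM uE; last by lia.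
rewrite /Mpoly ratr_eval_rem_Phi // ratr_evalM ratr_eval_prod.
by rewrite /b -mulrA [X in _ * X]mulrC.
Qed.

Lemma sum_wave_ser_ofps (Mhat : nat -> {poly rat}) t :
  (0 < f)%N ->
  (forall z, f.-primitive_root z -> fps_congr (ndvd a f) (gprod a f z)
    (\sum_(k < ndvd a f) lconst (ratr_eval (Mhat k) z) * lvar C ^+ k)) ->
  exists u, \sum_(z \in prim_roots C f) wave_ser a f t z = ofps u /\
    forall m, (m < ndvd a f)%N ->
      fps_coef u (ndvd a f - 1 - m) =
      \sum_(z \in prim_roots C f) z ^ (- t) * ratr_eval (Mpoly a f Mhat m) z.
Proof.
move=> f_gt0 MhatP; have [z pz] := prim_roots_exists C f_gt0.
exists (\sum_(k < f | f.-primitive_root (z ^+ k))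
   regular_part (wave_ser a f t (z ^+ k))); split=> [|m mn].
  rewrite (sum_prim_roots _ pz) /ofps rmorph_sum; apply: eq_bigr => k pk.
  by have [u [-> _]] := wave_ser_ofps t pk (MhatP _ pk); rewrite regular_part_ofps.
rewrite coef_fps_sum (sum_prim_roots _ pz); apply: eq_bigr => k pk.
have [u [-> uE]] := wave_ser_ofps t pk (MhatP _ pk).
by rewrite regular_part_ofps uE.
Qed.

(** Fourier inversion for [P * Phi_hat f * (PhiQ f)^`()]: only the primitive
    roots contribute, each with weight [f / z], which accounts for the shift
    from [th] to [th - 1]. *)
Lemma sum_prim_roots_PhiQ_dft (P : {poly rat}) (c : nat -> rat) t (th : nat) :
  (0 < f)%N -> (1 <= th <= f)%N -> (th = t %[mod f])%Z ->
  poly_congr ('X^f - 1) (P * Phi_hat f * (PhiQ f)^`()) (\sum_(i < f) c i *: 'X^i) ->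
  \sum_(z \in prim_roots C f) z ^ (- t) * ratr_eval P z = ratr (c (th - 1)%N).
Proof.
move=> f_gt0 /andP[th1 thf] tht Pc; have [z pz] := prim_roots_exists C f_gt0.
have f0 : f%:R != 0 :> C by rewrite pnatr_eq0 -lt0n.
have th_lt : (th - 1 < f)%N by lia.
apply: (mulfI f0); rewrite -(dft_coef (Ordinal th_lt) pz Pc).
rewrite (sum_prim_roots _ pz) mulr_sumr.
rewrite [RHS](bigID (fun k : 'I_f => f.-primitive_root (z ^+ k))) /=.
rewrite [X in _ = _ + X]big1 ?addr0 => [|k nk]; last first.
  rewrite !ratr_evalM (ratr_eval_Phi_hat_eq0 pz _ nk) ?mulr0 ?mul0r //.
  by rewrite exprAC (prim_expr_order pz) expr1n.
apply: eq_bigr => k pk; rewrite -mulrA ratr_evalM ratr_eval_Phi_hat_deriv //.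
have -> : (z ^+ k) ^ (- t) = (z ^+ k)^-1 ^+ th.
  rewrite exprnP exprz_inv; apply: (prim_root_expz_mod pk).
  by apply/eqP; rewrite eqz_mod_dvd opprK addrC -eqz_mod_dvd tht.
have -> : (z ^+ k)^-1 ^+ th = (z ^+ k)^-1 * (z ^+ k)^-1 ^+ (th - 1)%N.
  by rewrite -exprS; congr (_ ^+ _); lia.
rewrite [(z ^+ k)^-1 ^+ _]exprVn /=; set x := z ^+ k.
by ring.
Qed.

(** The function whose residue is the Sylvester wave, multiplied by [s^n]. *)
Lemma sylvester_waveE t : (0 < f)%N -> (forall i, 0 < a i)%N ->
  (\sum_(z \in prim_roots C f)
      (lconst (z ^ (- t)) * lexp (- t%:~R)
         / \prod_(i < N) (1 - lconst (z ^+ a i) * lexp (a i)%:R))) *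
    lvar C ^+ ndvd a f =
  lconst ((-1) ^+ ndvd a f / \prod_(i < N | (f %| a i)%N) (a i)%:R) *
    (lexp (- t%:~R) * \sum_(z \in prim_roots C f) wave_ser a f t z).
Proof.
move=> f_gt0 a_gt0; have [z pz] := prim_roots_exists C f_gt0.
have ndvdE : ndvd a f = #|[pred i : 'I_N | (f %| a i)%N]|.
  by rewrite /ndvd; apply: eq_card => i; rewrite inE.
set B := lconst (_ / _).
have BE : B / lvar C ^+ ndvd a f =
    \prod_(i < N | (f %| a i)%N) - (lconst (a i)%:R * lvar C)^-1.
  rewrite /B lconstM lconstV lconst_prod ndvdE -!prodr_const lconst_prod -!prodfV.
  rewrite -!big_split /=; apply: eq_bigr => i _.
  by rewrite lconstN lconst1 invfM mulN1r mulNr.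
have poleE (x : C) : f.-primitive_root x ->
    \prod_(i < N | (f %| a i)%N) (1 - lconst (x ^+ a i) * lexp (a i)%:R)^-1 =
    B / lvar C ^+ ndvd a f * \prod_(i < N | (f %| a i)%N) gser (a i)%:R.
  move=> px; rewrite BE -big_split /=.
  by apply: eq_bigr => i dvd_i; apply: pole_factor.
have regularE (x : C) : f.-primitive_root x ->
    \prod_(i < N | ~~ (f %| a i)%N) (1 - lconst (x ^+ a i) * lexp (a i)%:R)^-1 =
    \prod_(i < N | ~~ (f %| a i)%N) lconst (ratr_eval (vpoly a f i) x) *
    \prod_(i < N | ~~ (f %| a i)%N)
      gser2 (a i)%:R (ratr_eval (vpoly a f i) x - 1).
  move=> px; rewrite -big_split /=.
  by apply: eq_bigr => i ndvd_i; exact: regular_factor.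
(* Over an abstract field, where [field] need not unfold Laurent series. *)
have rearrange (F : fieldType) (A E b l G V H : F) : l != 0 ->
    A * E * (b / l * G * (V * H)) * l = b * (E * (A * V * (G * H))).
  by move=> l0; field.
rewrite !(sum_prim_roots _ pz) mulr_suml !mulr_sumr.
apply: eq_bigr => k pk; rewrite (bigID (fun i : 'I_N => (f %| a i)%N)) /=.
rewrite invfM -!prodfV poleE // regularE //.
by apply: rearrange; rewrite expf_neq0 ?lvar_neq0.
Qed.

End Wave.

Theorem theorem2p8 (R : realType) (N : nat) (a : 'I_N -> nat) (f : nat)
    (a_gt0 : forall i, (0 < a i)%N)
    (gcd_a : \big[gcdn/0%N]_(i < N) a i = 1%N)
    (f_gt1 : (1 < f)%N)
    (f_dvd : exists i, (f %| a i)%N)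
    (Mhat : nat -> {poly rat})
    (MhatP : forall z : CC R, f.-primitive_root z ->
      fps_congr (ndvd a f) (gprod a f z)
        (\sum_(k < ndvd a f) lconst (ratr_eval (Mhat k) z) * lvar (CC R) ^+ k))
    (c : nat -> nat -> rat)
    (cP : forall m, (m < ndvd a f)%N ->
      poly_congr ('X^f - 1)
        (Mpoly a f Mhat m * Phi_hat f * (PhiQ f)^`())
        (\sum_(i < f) c m i *: 'X^i)) :
  (forall (t m th : nat), (m < ndvd a f)%N ->
     (1 <= th <= f)%N -> th = t %[mod f] ->
     laurent_coef (\sum_(z \in prim_roots (CC R) f) wave_ser a f t z)
       (ndvd a f - 1 - m)%N = ratr (c m (th - 1)%N)) /\
  quasi_poly f (@sylvester_wave (CC R) N a f)
    (fun i => \sum_(m < ndvd a f)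
       ((-1) ^+ (ndvd a f + m + 1)
          / (m`!%:R * \prod_(k < N | (f %| a k)%N) (a k)%:R)
        * c m (i - 1)%N) *: 'X^m).
Proof.
have f_gt0 : (0 < f)%N := ltnW f_gt1.
have sumE (t : int) (th m : nat) : (m < ndvd a f)%N ->
    (1 <= th <= f)%N -> (th = t %[mod f])%Z ->
    \sum_(z \in prim_roots (CC R) f) z ^ (- t) * ratr_eval (Mpoly a f Mhat m) z =
    ratr (c m (th - 1)%N).
  move=> mn thf tht.
  exact: (sum_prim_roots_PhiQ_dft (CC R) f_gt0 thf tht (cP m mn)).
split=> [t m th mn thf tht | t i i_f ti].
  have [u [-> uE]] := sum_wave_ser_ofps t f_gt0 MhatP.
  rewrite laurent_coef_ofps uE //; apply: sumE => //.
  by rewrite !modz_nat tht.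
have [u [uS uE]] := sum_wave_ser_ofps t f_gt0 MhatP.
have n_gt0 : (0 < ndvd a f)%N.
  by have [i0 dvd_i0] := f_dvd; apply/card_gt0P; exists i0; rewrite inE.
pose B : CC R := (-1) ^+ ndvd a f / \prod_(k < N | (f %| a k)%N) (a k)%:R.
have := sylvester_waveE (CC R) t f_gt0 a_gt0.
rewrite uS -/B -!tofracM => /laurent_coefE; rewrite /sylvester_wave /residue => ->.
(* The residue is the coefficient of index [n - 1] after the shift by [s^n]. *)
have -> : (-1) + (ndvd a f)%:Z = (ndvd a f - 1)%N by lia.
rewrite coef_fpsCM coef_fpsM -subSn // subn1 /=.
rewrite ratr_eval_sum mulr_sumr -sumrN.
apply: eq_bigr => m _.
rewrite uE // (sumE _ i) // ratr_evalZ ratr_evalXn /B.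
have prodE : ratr (\prod_(k < N | (f %| a k)%N) (a k)%:R) =
    \prod_(k < N | (f %| a k)%N) (a k)%:R :> CC R.
  by rewrite rmorph_prod; apply: eq_bigr => k _; rewrite rmorph_nat.
rewrite 2!rmorphM fmorphV rmorphM /= prodE ratr_nat rmorphXn rmorphN1.
rewrite [(- _) ^+ m]exprNn !exprD expr1 invfM.
(* Over an abstract field, where [ring] need not unfold the complex numbers. *)
have rearrange (F : fieldType) (b d q x p r : F) :
    - (b * q * (d * x * p * r)) = b * d * -1 * (p * q) * r * x by ring.
exact: (rearrange (CC R)).
Qed.
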